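(* The set $V := \{\alpha \in (0,1) : M_\alpha \text{ is a valuation monoid}\}$ is dense in the real interval $(0,1)$.
   Context: $\mathbb{N}_0 = \{0,1,2,\dots\}$. For $\alpha \in \mathbb{C}$, $M_\alpha := \{p(\alpha) : p(x) \in \mathbb{N}_0[x]\}$, viewed as a (cancellative commutative) monoid under addition, where $\mathbb{N}_0[x]$ is the set of polynomials with nonnegative integer coefficients; throughout, $\alpha$ is assumed to be algebraic over $\mathbb{Q}$. For an additively written monoid $M$ and $a,b \in M$, $b \mid_M a$ means $a = b + c$ for some $c \in M$; $M$ is a valuation monoid if for all $a,b \in M$ either $a \mid_M b$ or $b \mid_M a$. *)

(* Defs.v *)
From mathcomp Require Import all_boot all_order all_algebra.
From mathcomp Require Import all_classical all_reals all_analysis.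
Set Implicit Arguments.
Unset Strict Implicit.
Unset Printing Implicit Defensive.
Import Order.TTheory GRing.Theory Num.Theory.
Import numFieldNormedType.Exports.

Local Open Scope classical_set_scope.
Local Open Scope ring_scope.

(* A submonoid of an additive monoid U is given by its carrier M : set U;
   divisibility is relative to M, so the quotient must lie in M. *)
Definition submonoid (U : nmodType) (M : set U) : Prop :=
  M 0 /\ (forall a b, M a -> M b -> M (a + b)).

Definition mdvd (U : nmodType) (M : set U) (b a : U) : Prop :=
  exists2 c, M c & a = b + c.

Definition valuation_monoid (U : nmodType) (M : set U) : Prop :=
  submonoid M /\
  forall a b, M a -> M b -> mdvd M b a \/ mdvd M a b.

Definition Nx_eval (R : nzRingType) (alpha : R) : set R :=
  [set (map_poly (GRing.natmul 1) p).[alpha] | p in [set: {poly nat}]].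

Lemma Nx_eval_submonoid (R : nzRingType) (alpha : R) :
  submonoid (Nx_eval alpha).
Proof.
split; first by exists 0 => //; rewrite rmorph0 horner0.
move=> _ _ [p _ <-] [q _ <-]; exists (p + q) => //.
by rewrite rmorphD hornerD.
Qed.

Definition valuation_set (R : realType) : set R :=
  [set alpha | [/\ alpha \in `]0, 1[,
                   algebraicOver (@ratr R) alpha &
                   valuation_monoid (Nx_eval alpha)]].

(* Main.v *)
Require Import Defs.
From mathcomp Require Import all_boot all_order all_algebra.
From mathcomp Require Import all_classical all_reals all_analysis.
From mathcomp Require Import zify ring lra.
Import Order.TTheory GRing.Theory Num.Theory.
Import numFieldNormedType.Exports.

Local Open Scope classical_set_scope.
Local Open Scope ring_scope.

(** Let alpha in (0,1) be a root of k X^m + X^(m+1) - 1; such roots are dense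
    since k t^m + t^(m+1) crosses 1 on any [s, t] once m is large and k is the
    least integer with k t^m >= 1. The relation
    alpha^n = k alpha^(n+m) + alpha^(n+m+1) lets one rewrite an element x of
    Z[alpha] as an integer combination of higher and higher powers of alpha,
    whose coefficients h satisfy h(n+m+1) = k h(n+1) + h(n). The rescaled
    sequence h(n) alpha^n is then a moving average with weights k alpha^m and
    alpha^(m+1), on the coprime lags m and m+1, so its oscillation tends to 0
    while x stays a fixed positive combination of its values. If x > 0 the
    coefficients are therefore eventually nonnegative, and x lies in M_alpha. *)

Lemma exists_exp_lt (R : archiRealFieldType) (r e : R) :
  0 <= r < 1 -> 0 < e -> exists n, r ^+ n < e.
Proof.
move=> /andP[r0 r1] e0.
have /cvg_expr/cvgr_lt/(_ _ e0)[n _ hn] : `|r| < 1 by rewrite ger0_norm.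
by exists n; apply: hn => /=.
Qed.

(** * Decay of oscillation for moving averages with two lags *)

Section TwoTermRecurrence.
Variables (R : archiRealFieldType) (m : nat) (p q : R).
Hypotheses (m_gt0 : (0 < m)%N) (p_gt0 : 0 < p) (q_gt0 : 0 < q) (pq1 : p + q = 1).

Definition averaging (v : nat -> R) : Prop :=
  forall n, v (n + m.+1)%N = p * v n.+1 + q * v n.

Lemma averaging_shift v k : averaging v -> averaging (fun n => v (k + n)%N).
Proof. by move=> hv n; rewrite addnA hv addnS. Qed.

Lemma averagingN v : averaging v -> averaging (fun n => - v n).
Proof. by move=> hv n; rewrite hv; ring. Qed.

Lemma averagingB v a : averaging v -> averaging (fun n => v n - a).
Proof. by move=> hv n; rewrite hv -[in LHS](mul1r a) -pq1; ring. Qed.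

Lemma averaging_ge0 {v} : averaging v ->
  (forall i, (i <= m)%N -> 0 <= v i) -> forall i, 0 <= v i.
Proof.
move=> hv v0 i; have [n] := ubnP i; elim: n i => // n IH i lt_in.
have [/v0 //|lt_mi] := leqP i m.
have -> : i = (i - m.+1 + m.+1)%N by lia.
by rewrite hv addr_ge0 // mulr_ge0 ?(ltW p_gt0) ?(ltW q_gt0) // IH //; lia.
Qed.

(* m.+1 + k * m + r is reached from 0 by k.+1 steps of length m or m.+1, each
   keeping at least the proportion min p q; the first one must be m.+1, since
   index m is not constrained by the recurrence. *)
Lemma averaging_spread v : averaging v ->
  (forall i, (i <= m)%N -> 0 <= v i) ->
  forall k r, (r <= k)%N ->
  Num.min p q ^+ k.+1 * v 0%N <= v (m.+1 + k * m + r)%N.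
Proof.
move=> hv v_ge0; have v0 := averaging_ge0 hv v_ge0.
have m0 : 0 <= Num.min p q by rewrite le_min !ltW.
have step_p n : Num.min p q * v n.+1 <= v (n + m.+1)%N.
  rewrite hv -[leLHS]addr0 lerD ?mulr_ge0 ?ler_wpM2r ?ge_min ?lexx ?v0 //.
  exact: ltW.
have step_q n : Num.min p q * v n <= v (n + m.+1)%N.
  rewrite hv -[leLHS]add0r lerD ?mulr_ge0 ?ler_wpM2r ?ge_min ?lexx ?orbT ?v0 //.
  exact: ltW.
elim=> [|k IH] r.
  by rewrite leqn0 => /eqP ->; rewrite mul0n !addn0 expr1 -[m.+1]add0n.
rewrite leq_eqVlt ltnS exprS -mulrA => /orP[/eqP ->|le_rk].
- have -> : (m.+1 + k.+1 * m + k.+1 = (m.+1 + k * m + k) + m.+1)%N by lia.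
  by apply: le_trans (step_q _); rewrite ler_wpM2l // IH.
- have -> : (m.+1 + k.+1 * m + r = (m + k * m + r) + m.+1)%N by lia.
  apply: le_trans (step_p _); rewrite ler_wpM2l //.
  by have := IH _ le_rk; rewrite !addSn.
Qed.

(** The constants of the spread bound at [k = m], where the offsets [r <= k] cover a full window of
    [m.+1] indices. *)
Let c := 1 - Num.min p q ^+ m.+1.
Let T := (m.+1 + m * m)%N.

Let c_itv : 0 <= c < 1.
Proof.
rewrite /c; have m0 : 0 < Num.min p q by rewrite lt_min p_gt0.
have m1 : Num.min p q <= 1 by rewrite ge_min; apply/orP; left; move: q_gt0 pq1; lra.
have := exprn_gt0 m.+1 m0; have := exprn_ile1 m.+1 (ltW m0) m1; lra.
Qed.

(* The lower and upper bounds both move towards v n, so the oscillation over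
   a window shrinks by the factor c every T steps. *)
Lemma averaging_oscillation v : averaging v -> forall lo hi,
  (forall i, (i <= m)%N -> lo <= v i <= hi) ->
  forall k, exists n a b, b - a = c ^+ k * (hi - lo) /\
    forall i, (i <= m)%N -> a <= v (n + i)%N <= b.
Proof.
move=> hv lo hi hb; elim=> [|k [n [a [b [hab hw]]]]].
  by exists 0%N, lo, hi; split=> //; rewrite expr0 mul1r.
set d := Num.min p q ^+ m.+1.
exists (n + T)%N, (a + d * (v n - a)), (b - d * (b - v n)); split.
  by rewrite exprS -mulrA -hab /c -/d; ring.
move=> i le_im.
have hn := averaging_shift v n hv.
have lo' j : (j <= m)%N -> 0 <= v (n + j)%N - a by move/hw/andP=> [? ?]; lra.
have hi' j : (j <= m)%N -> 0 <= - v (n + j)%N - (- b) by move/hw/andP=> [? ?]; lra.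
(* The spread bound is applied to [v - a] and to [b - v]. *)
have /= := averaging_spread _ (averagingB _ a hn) lo' m i le_im.
have /= := averaging_spread _ (averagingB _ (- b) (averagingN _ hn)) hi' m i le_im.
by rewrite -/d -/T addn0 addnA; lra.
Qed.

(** A linear invariant: from [n] to [n.+1] it changes by v(n+m+1) - p v(n+1) - q v(n) when p + q =
    1. *)
Definition mass (v : nat -> R) (n : nat) : R :=
  \sum_(i < m) v (n + i.+1)%N + q * v n.

Lemma mass_const v n : averaging v -> mass v n = mass v 0.
Proof.
move=> hv; elim: n => // n <-; rewrite /mass.
have : \sum_(i < m.+1) v (n + i.+1)%N = \sum_(i < m.+1) v (n + i.+1)%N by [].
rewrite [LHS]big_ord_recl [RHS]big_ord_recr /= addn1 hv.
under eq_bigr do rewrite /bump /= add1n -addSnnS.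
have -> : p = 1 - q by rewrite -pq1 addrK.
lra.
Qed.

(** As the mass is conserved, every upper bound of a window is at least [mass v 0 / m.+1]; once the
    oscillation is smaller than this, the lower bound is positive. *)
Lemma averaging_eventually_ge0 v : averaging v -> 0 < mass v 0 ->
  exists n, forall i, (i <= m)%N -> 0 <= v (n + i)%N.
Proof.
move=> hv S_gt0.
pose D := \sum_(i < m.+1) `|v i|.
have D_ge0 : 0 <= D by apply: sumr_ge0.
have hD i : (i <= m)%N -> - D <= v i <= D.
  move=> le_im; rewrite -ler_norml /D (bigD1 (Ordinal (le_im : (i < m.+1)%N))) //=.
  by rewrite lerDl sumr_ge0.
(* [D + D] is the width of the initial bounds; adding 1 makes the divisor visibly positive. *)
pose e := mass v 0 / m.+1%:R / (D + D + 1).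
have e_gt0 : 0 < e by rewrite !divr_gt0 ?ltr0n //; lra.
have [k hk] := exists_exp_lt _ _ _ c_itv e_gt0.
have [n [a [b [hab hw]]]] := averaging_oscillation v hv _ _ hD k.
exists n => i0 /hw/andP[le_a _]; apply: le_trans le_a.
have hba : b - a < mass v 0 / m.+1%:R.
  have D1 : 0 < D + D + 1 by lra.
  move: hk; rewrite ltr_pdivlMr // => /le_lt_trans; apply.
  by rewrite hab ler_wpM2l ?exprn_ge0 //; [case/andP: c_itv|lra].
have hb i : (i <= m)%N -> v (n + i)%N <= b by move/hw => /andP[].
have mass_le : mass v 0 <= m%:R * b + q * b.
  rewrite -(mass_const v n hv) lerD //.
    rewrite mulr_natl -[m in X in _ <= X]card_ord -sumr_const.
    by apply: ler_sum => j _; apply: hb.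
  by apply: (ler_wpM2l (ltW q_gt0)); have := hb 0%N (leq0n m); rewrite addn0.
have b_gt0 : 0 < b.
  rewrite ltNge; apply/negP => b_le0; move: S_gt0; apply/negP.
  rewrite -leNgt (le_trans mass_le) // -mulrDl mulr_ge0_le0 // addr_ge0 ?ler0n //.
  exact: ltW.
have : mass v 0 / m.+1%:R <= b.
  rewrite ler_pdivrMr ?ltr0n // (le_trans mass_le) // -[m.+1]addn1 natrD.
  have : q * b <= b by rewrite ler_piMl ?ltW //; move: p_gt0 pq1; lra.
  by lra.
move: hba; set X := mass v 0 / _; lra.
Qed.

End TwoTermRecurrence.

(** * Elements of Z[alpha] as windows of an integer recurrence *)

Section Root.
Variables (R : archiRealFieldType) (m k : nat) (alpha : R).
Hypotheses (m_gt0 : (0 < m)%N) (k_gt0 : (0 < k)%N).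
Hypotheses (alpha_gt0 : 0 < alpha).
Hypothesis alphaE : k%:R * alpha ^+ m + alpha ^+ m.+1 = 1.

Definition recurrent (h : nat -> int) : Prop :=
  forall n, h (n + m.+1)%N = k%:Z * h n.+1 + h n.

Definition scaled (h : nat -> int) (n : nat) : R := (h n)%:~R * alpha ^+ n.

(* The element of Z[alpha] represented by the window h 0, ..., h m. *)
Definition value (h : nat -> int) : R := mass R m (alpha ^+ m.+1) (scaled h) 0.

Lemma exists_recurrent (w : nat -> int) :
  exists2 h, recurrent h & forall i, (i <= m)%N -> h i = w i.
Proof.
(* A step shifts the window left and puts the next term at index [m]; entries beyond [m] are
   irrelevant. *)
pose step (u : nat -> int) i :=
  if (i < m)%N then u i.+1 else k%:Z * u 1%N + u 0%N.
have iterE i : (i <= m)%N -> forall n, iter n step w i = iter (n + i) step w 0%N.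
  elim: i => [_ n|i IH lt_im n]; first by rewrite addn0.
  by rewrite addnS -addSn -IH ?(ltnW lt_im) //= /step lt_im.
exists (fun n => iter n step w 0%N) => [n|i le_im]; last by rewrite -[i]add0n -iterE.
rewrite addnS -addSn -iterE // -(addn1 n) -iterE // addn1.
by rewrite /= {1}/step ltnn.
Qed.

Lemma scaled_averaging h :
  recurrent h -> averaging R m (k%:R * alpha ^+ m) (alpha ^+ m.+1) (scaled h).
Proof.
move=> hh n; rewrite /scaled hh rmorphD rmorphM /= exprD exprS.
by rewrite !exprS -[(k%:Z)%:~R]/(k%:R); ring.
Qed.

Lemma Nx_eval_monomial (c j : nat) : Nx_eval alpha (c%:R * alpha ^+ j).
Proof.
exists ('X^j *+ c) => //.
by rewrite rmorphMn /= map_polyXn hornerMn hornerXn mulr_natl.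
Qed.

(** Sliding the window until its entries are nonnegative does not change the value, which is then a
    sum of natural multiples of powers of [alpha]. *)
Lemma value_Nx_eval h : recurrent h -> 0 < value h -> Nx_eval alpha (value h).
Proof.
move=> hh v_gt0; have hv := scaled_averaging h hh.
have [M0 MD] := Nx_eval_submonoid alpha.
have p_gt0 : 0 < k%:R * alpha ^+ m by rewrite mulr_gt0 ?ltr0n ?exprn_gt0.
have q_gt0 : 0 < alpha ^+ m.+1 by rewrite exprn_gt0.
have [n hn] := averaging_eventually_ge0 _ _ _ _ m_gt0 p_gt0 q_gt0 alphaE _ hv v_gt0.
have h_nat i : (i <= m)%N -> (h (n + i)%N)%:~R = `|h (n + i)%N|%N%:R :> R.
  move=> /hn; rewrite /scaled pmulr_lge0 ?exprn_gt0 // ler0z => h_ge0.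
  by rewrite natr_absz ger0_norm.
rewrite /value -(mass_const _ _ _ _ alphaE _ n hv); apply: (MD).
  apply: big_ind => // i _; rewrite /scaled h_nat //; exact: Nx_eval_monomial.
rewrite /scaled -[n]addn0 h_nat // mulrCA -exprD; exact: Nx_eval_monomial.
Qed.

(** Shown below to contain 1 and to be stable under subtraction and multiplication by [alpha], hence
    to contain all differences of elements of M_alpha. *)
Definition attained (x : R) : Prop := exists2 h, recurrent h & value h = x.

Lemma attained0 : attained 0.
Proof.
exists (fun _ => 0) => [n|]; first by rewrite mulr0.
rewrite /value /mass /scaled mul0r mulr0 addr0 big1 // => i _.
by rewrite mul0r.
Qed.

Lemma attainedB x y : attained x -> attained y -> attained (x - y).
Proof.
move=> [h hh <-] [g hg <-]; exists (fun n => h n - g n) => [n|].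
  by rewrite hh hg; ring.
rewrite /value /mass /scaled rmorphB /= mulrBl mulrBr.
under eq_bigr do rewrite rmorphB /= mulrBl.
by rewrite sumrB; ring.
Qed.

Lemma attainedD x y : attained x -> attained y -> attained (x + y).
Proof.
move=> hx hy; rewrite -[y]opprK -[- y]add0r.
exact: attainedB hx (attainedB _ _ attained0 hy).
Qed.

Lemma attained1 : attained 1.
Proof.
(* The window encodes 1 = k alpha^m + alpha^(m+1): in [value], [h m] has weight alpha^m and [h 0]
   has weight alpha^(m+1). *)
have [h hh hw] := exists_recurrent
  (fun i => if i == 0%N then 1 else if i == m then k%:Z else 0).
exists h => //; rewrite /value /mass /scaled (hw 0%N) //= expr0 !mulr1 -[RHS]alphaE.
have lt_pm : (m.-1 < m)%N by rewrite prednK.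
congr (_ + _); rewrite (bigD1 (Ordinal lt_pm)) //= add0n prednK // hw // eqxx.
rewrite gtn_eqF //= big1 ?addr0 // => i ne_i; rewrite add0n hw //=.
rewrite ifN ?mul0r //; apply: contraNneq ne_i => eq_im.
by apply/eqP/val_inj; rewrite /= -[X in X.-1]eq_im.
Qed.

Lemma attainedM x : attained x -> attained (alpha * x).
Proof.
move=> [h hh <-].
(* [g] extends [h] one place to the left, with first term forced by the recurrence; its mass at 1 is
   [alpha] times that of [h] at 0. *)
pose g n := if n is n'.+1 then h n' else h m - k%:Z * h 0%N.
have hg : recurrent g.
  case=> [|n] /=; last exact: hh.
  ring.
exists g => //; rewrite /value -(mass_const _ _ _ _ alphaE _ 1 (scaled_averaging g hg)).
rewrite /mass /scaled mulrDr mulr_sumr; congr (_ + _).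
  by apply: eq_bigr => i _; rewrite add1n add0n /= exprS; ring.
by rewrite /= expr0 expr1; ring.
Qed.

Lemma Nx_eval_attained x : Nx_eval alpha x -> attained x.
Proof.
move=> [p _ <-]; rewrite horner_coef; apply: big_ind => [||i _].
- exact: attained0.
- exact: attainedD.
rewrite coef_map /=; move: (p`_i) => c; elim: (nat_of_ord i) => [|j IH].
  rewrite expr0 mulr1; elim: c => [|c IH]; first exact: attained0.
  rewrite -natr1; apply: attainedD; [exact: IH|exact: attained1].
by rewrite exprS mulrCA; apply: attainedM.
Qed.

Lemma Nx_eval_valuation : valuation_monoid (Nx_eval alpha).
Proof.
split=> [|a b Ma Mb]; first exact: Nx_eval_submonoid.
have lt_mdvd x y : Nx_eval alpha x -> Nx_eval alpha y -> x < y ->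
    mdvd (Nx_eval alpha) x y.
  move=> /Nx_eval_attained hx /Nx_eval_attained hy lt_xy.
  have [h hh hv] := attainedB _ _ hy hx.
  exists (y - x); last by rewrite addrC subrK.
  by rewrite -hv; apply: value_Nx_eval; rewrite ?hv ?subr_gt0.
have [lt_ab|lt_ba|->] := ltgtP a b;
  [by right; apply: lt_mdvd|by left; apply: lt_mdvd|left].
by exists 0; [case: (Nx_eval_submonoid alpha)|rewrite addr0].
Qed.

End Root.

(** * Density of the roots in the unit interval *)

Lemma exists_root (R : archiRcfType) (s t : R) : 0 < s < t -> t < 1 ->
  exists m k alpha, [/\ (0 < m)%N, (0 < k)%N, s <= alpha <= t &
    root (k%:R *: 'X^m + 'X^(m.+1) - 1) alpha].
Proof.
move=> /andP[s_gt0 lt_st] t_lt1; have t_gt0 := lt_trans s_gt0 lt_st.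
have r_itv : 0 <= s / t < 1 by rewrite divr_ge0 ?ltW //= ltr_pdivrMr ?mul1r.
(* The value k s^m + s^(m+1) will be at most (s/t)^m + s^m + s^(m+1), three terms each bounded by
   (s/t)^m; hence 1/3. *)
have [||n hn] := exists_exp_lt R (s / t) 3%:R^-1 => //.
have {hn} : (s / t) ^+ n.+1 < 3%:R^-1.
  apply: le_lt_trans hn; rewrite exprS ler_piMl ?exprn_ge0 //.
    by case/andP: r_itv.
  by case/andP: r_itv => _ /ltW.
set m := n.+1 => hm.
pose k := (Num.truncn (t ^- m)).+1.
have tm_gt0 : 0 < t ^+ m by rewrite exprn_gt0.
have sm_gt0 : 0 < s ^+ m by rewrite exprn_gt0.
have k_gt : 1 <= k%:R * t ^+ m by rewrite -ler_pdivrMr // mul1r ltW // truncnS_gt.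
have k_le : k%:R <= t ^- m + 1.
  have tm_ge0 : 0 <= t ^- m by rewrite invr_ge0 ltW.
  by rewrite /k -natr1 lerD2r; case/andP: (truncn_itv tm_ge0).
have [|alpha hal hr] := @poly_ivt R (k%:R *: 'X^m + 'X^(m.+1) - 1) s t (ltW lt_st).
  rewrite !hornerE !subr_le0 !subr_ge0; apply/andP; split.
    have ks_le : k%:R * s ^+ m <= (s / t) ^+ m + s ^+ m.
      rewrite expr_div_n -[X in _ <= _ + X]mul1r [X in _ <= X + _]mulrC -mulrDl.
      by apply: ler_wpM2r k_le; exact: ltW.
    have s_le : s ^+ m <= (s / t) ^+ m.
      rewrite expr_div_n ler_pdivlMr // ler_piMr ?(ltW sm_gt0) //.
      by rewrite exprn_ile1 ?ltW.
    have : s ^+ m.+1 <= s ^+ m.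
      by rewrite exprS ler_piMl ?(ltW sm_gt0) // ltW // (lt_trans lt_st).
    lra.
  by rewrite (le_trans k_gt) // lerDl exprn_ge0 // ltW.
by exists m, k, alpha.
Qed.

Theorem theorem5p10 (R : realType) :
  `]0, 1[ `<=` closure (@valuation_set R).
Proof.
move=> x; rewrite /= in_itv /= => /andP[x_gt0 x_lt1] B /nbhs_ballP[e /= e_gt0 hB].
(* This keeps [s] positive and [s, x] inside the ball of radius [e]. *)
pose s := Num.max (x / 2) (x - e / 2).
have [||m [k [a [m_gt0 k_gt0 /andP[sa ax] ra]]]] := exists_root R s x => //.
  rewrite /s lt_max gt_max; lra.
have a_gt0 : 0 < a by apply: lt_le_trans sa; rewrite lt_max; lra.
exists a; split; last first.
  apply: hB; rewrite /ball /= ger0_norm ?subr_ge0 //.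
  by move: sa; rewrite ge_max => /andP[_]; lra.
split.
- by rewrite in_itv /= a_gt0 (le_lt_trans ax).
- exists (k%:R *: 'X^m + 'X^(m.+1) - 1).
    (* The polynomial is nonzero because it takes the value -1 at 0. *)
    apply/eqP => /(congr1 (horner^~ 0)).
    rewrite !hornerE !expr0n gtn_eqF //= mulr0 addr0 add0r => /eqP.
    by rewrite oppr_eq0 oner_eq0.
  by rewrite rmorphB rmorphD rmorph1 /= linearZ /= !map_polyXn ratr_nat.
- apply: (Nx_eval_valuation _ m k) => //.
  by move: ra; rewrite rootE !hornerE subr_eq0 => /eqP.
Qed.
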